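(* For every positive integer $n$, \[\mathsf{pf}_n(132)=\mathsf{pf}_n(231)=\sum_{\alpha\vDash n}\det\left[\binom{j-i+\sum_{\ell=1}^{i}\alpha_\ell}{j-(i-1)}\right]\det\left[\binom{j+\sum_{\ell=1}^{i}\alpha_{k+1-\ell}}{j-(i-1)}\right],\] \[\mathsf{pf}_n(213)=\mathsf{pf}_n(312)=\sum_{\alpha\vDash n}\det\left[\binom{j-i+\sum_{\ell=1}^{i}\alpha_\ell}{j-(i-1)}\right]\det\left[\binom{j+\sum_{\ell=1}^{i}\alpha_{\ell}}{j-(i-1)}\right],\] where the sums run over all compositions $\alpha=(\alpha_1,\dots,\alpha_k)$ of $n$, $k$ is the number of parts of $\alpha$, and in every determinant the indices range over $1\le i,j\le k-1$ (empty determinants equal $1$).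
   Context: $[n]=\{1,\dots,n\}$. A tuple $p=(p_1,\dots,p_n)\in[n]^n$ is a parking function if its weakly increasing rearrangement $(p'_1,\dots,p'_n)$ satisfies $p'_i\le i$ for all $i$. To a parking function $p$ associate the permutation $\pi(p)$ obtained by listing, for $s=1,2,\dots,n$ in turn, the indices $j$ with $p_j=s$ in increasing order, and concatenating these lists. A permutation $\pi$ avoids $\sigma\in\mathfrak S_3$ if no subsequence of $\pi$ of length 3 is order-isomorphic to $\sigma$. For $\sigma\in\mathfrak S_3$, $\mathsf{pf}_n(\sigma)$ is the number of parking functions $p$ of length $n$ such that $\pi(p)$ avoids $\sigma$. Binomial coefficients $\binom{N}{r}$ with $r<0$ are $0$. *)

(* Defs.v *)
From mathcomp Require Import all_boot all_order all_algebra.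
Set Implicit Arguments. Unset Strict Implicit. Unset Printing Implicit Defensive.
Import Order.TTheory GRing.Theory Num.Theory.

(* A tuple p in [n]^n is encoded as f : {ffun 'I_n -> 'I_n} with
   p_{j+1} = (f j) + 1  (indices and values shifted by one). *)

Definition pf_seq n (f : {ffun 'I_n -> 'I_n}) : seq nat :=
  [seq (val (f x)).+1 | x <- enum 'I_n].

Definition is_parking n (f : {ffun 'I_n -> 'I_n}) : bool :=
  let s := sort leq (pf_seq f) in
  [forall i : 'I_n, nth 0 s i <= i.+1].

Definition pf_perm n (f : {ffun 'I_n -> 'I_n}) : seq nat :=
  flatten [seq [seq j.+1 | j <- iota 0 n & nth 0 (pf_seq f) j == s]
          | s <- iota 1 n].

Definition contains (pi sigma : seq nat) : bool :=
  [exists a : 'I_(size pi), exists b : 'I_(size pi), exists c : 'I_(size pi),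
     [&& a < b, b < c &
      let t := [:: nth 0 pi a; nth 0 pi b; nth 0 pi c] in
      [forall x : 'I_3, forall y : 'I_3,
         (nth 0 t x < nth 0 t y) == (nth 0 sigma x < nth 0 sigma y)]]].

Definition avoids (pi sigma : seq nat) : bool := ~~ contains pi sigma.

Definition pfn (n : nat) (sigma : seq nat) : nat :=
  #|[set f : {ffun 'I_n -> 'I_n} | is_parking f && avoids (pf_perm f) sigma]|.

Definition p132 : seq nat := [:: 1; 3; 2].
Definition p231 : seq nat := [:: 2; 3; 1].
Definition p213 : seq nat := [:: 2; 1; 3].
Definition p312 : seq nat := [:: 3; 1; 2].

(* binomial coefficient with integer arguments, 0 when the bottom is negative;
   (the top is always nonnegative in the use below) *)
Definition binz (N r : int) : int :=
  if (0 <= r)%R && (0 <= N)%R then Posz 'C(`|N|%N, `|r|%N) else 0%R.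

(* A composition of n with k parts is encoded as a : {ffun 'I_k -> 'I_n.+1}
   with every part positive and parts summing to n; alpha_l = val (a (l-1)). *)
Definition is_comp n k (a : {ffun 'I_k -> 'I_n.+1}) : bool :=
  [forall l, 0 < val (a l)] && (\sum_(l < k) val (a l) == n).

Definition psum_first n k (a : {ffun 'I_k -> 'I_n.+1}) (i : nat) : nat :=
  \sum_(l < k | l < i) val (a l).
Definition psum_last n k (a : {ffun 'I_k -> 'I_n.+1}) (i : nat) : nat :=
  \sum_(l < k | k - i <= l) val (a l).

Local Open Scope ring_scope.

Definition detA n k (a : {ffun 'I_k -> 'I_n.+1}) : int :=
  \det (\matrix_(i < k.-1, j < k.-1)
          binz ((Posz (j.+1)) - (Posz (i.+1)) + (Posz (psum_first a i.+1)))
               ((Posz (j.+1)) - ((Posz (i.+1)) - 1))).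

Definition detB n k (a : {ffun 'I_k -> 'I_n.+1}) : int :=
  \det (\matrix_(i < k.-1, j < k.-1)
          binz ((Posz (j.+1)) + (Posz (psum_last a i.+1)))
               ((Posz (j.+1)) - ((Posz (i.+1)) - 1))).

Definition detC n k (a : {ffun 'I_k -> 'I_n.+1}) : int :=
  \det (\matrix_(i < k.-1, j < k.-1)
          binz ((Posz (j.+1)) + (Posz (psum_first a i.+1)))
               ((Posz (j.+1)) - ((Posz (i.+1)) - 1))).

Definition rhs1 (n : nat) : int :=
  \sum_(k < n.+1) \sum_(a : {ffun 'I_k -> 'I_n.+1} | is_comp a) detA a * detB a.
Definition rhs2 (n : nat) : int :=
  \sum_(k < n.+1) \sum_(a : {ffun 'I_k -> 'I_n.+1} | is_comp a) detA a * detC a.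

(* Main.v *)
Require Import Defs.
From mathcomp Require Import all_boot all_order all_algebra.
From mathcomp Require Import zify.
Set Implicit Arguments. Unset Strict Implicit. Unset Printing Implicit Defensive.
Import Order.TTheory GRing.Theory Num.Theory.

(* A pattern of pi(f) is a triple of positions in the word f(0) f(1) ... whose
   letters satisfy a weak-order condition, so the parking functions to be counted
   are the words avoiding that condition whose content (the vector of letter
   multiplicities) satisfies the ballot condition.  Sort them by the composition
   alpha of n formed by the nonzero multiplicities.
   - The contents with nonzero part alpha correspond to sequences
     1 <= t_1 < ... < t_(k-1) with t_i <= alpha_1 + ... + alpha_i.
   - Words of given content are built by inserting the letters block by block,
     largest letter last.  For both 213 and 312, inserting x copies of the next
     letter into a word with L admissible sites gives L words, which have
     x + 1, ..., x + L admissible sites.  Unwinding this tree gives sequences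
     1 <= t_1 < ... < t_(k-1) with t_i <= i + alpha_1 + ... + alpha_i.
     Reverse-complementation turns 132 and 231 into 213 and 312 and reverses alpha.
   - The number of sequences 1 <= t_1 < ... < t_m with t_i <= b_i, for b weakly
     increasing, is det [ multichoose(b_i, j - i + 1) ]: this matrix is Hessenberg
     with unit subdiagonal, and expanding along the last row, with an arbitrary
     last column, reproduces the recursion for the sequences. *)

(** * Bounded increasing sequences and Hessenberg determinants *)

(** The number of multisets of size [r] on [x] types. The truncated predecessor gives the right
    values at [x = 0]: one multiset for [r = 0], none otherwise. *)
Definition multichoose x r := 'C((x + r).-1, r).

Lemma multichoose0 x : multichoose x 0 = 1.
Proof. by rewrite /multichoose bin0. Qed.

Lemma multichoose0S r : multichoose 0 r.+1 = 0.
Proof. by rewrite /multichoose add0n bin_small. Qed.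

Lemma multichooseSS x r :
  multichoose x.+1 r.+1 = multichoose x r.+1 + multichoose x.+1 r.
Proof. by rewrite /multichoose !addnS addSn /= binS addnC. Qed.

(** Hockey-stick identity, by telescoping [multichooseSS]. *)
Lemma sum_multichoose r z b : z <= b ->
  \sum_(z.+1 <= y < b.+1) multichoose y r + multichoose z r.+1
  = multichoose b r.+1.
Proof.
move=> /subnKC<-; elim: (b - z) => [|d IHd].
  by rewrite addn0 big_geq.
by rewrite addnS big_nat_recr ?ltnS ?leq_addr //= addnAC IHd -multichooseSS.
Qed.

(* [chains b i y] is the number of sequences [1 <= t_1 < ... < t_i = y] with
   [t_j <= b j.-1]; the empty sequence is taken to end at [y = 0]. *)
Fixpoint chains (b : nat -> nat) (i y : nat) : nat :=
  if i is i'.+1 then (y <= b i') * \sum_(0 <= z < y) chains b i' z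
  else (y == 0).

(** The weight [multichoose y r] on the last term will match a determinant whose last column is
    shifted by [r]; at [r = 0] it is a plain count of sequences ending below [N]. *)
Definition chain_sum b i N r := \sum_(0 <= y < N) chains b i y * multichoose y r.

Lemma chains_gt b i y : chains b i.+1 y != 0 -> y <= b i.
Proof. by rewrite /=; case: leqP. Qed.

(** Fix the [m]-th term [z]. Summing the weight over the next term, from [z + 1] to [b m], and
    adding [multichoose z r.+1] gives [multichoose (b m) r.+1], which no longer depends on [z]. *)
Lemma chain_sumS b m r N : {homo b : i j / i <= j} -> b m < N ->
  chain_sum b m.+1 N r + chain_sum b m N r.+1
  = multichoose (b m) r.+1 * chain_sum b m N 0.
Proof.
move=> b_mono ltbN; rewrite /chain_sum.
transitivity (\sum_(0 <= z < N) chains b m z *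
    (\sum_(z.+1 <= y < (b m).+1) multichoose y r + multichoose z r.+1)).
  under [RHS]eq_bigr do rewrite mulnDr.
  rewrite big_split /=; congr (_ + _).
  transitivity (\sum_(0 <= y < N) \sum_(0 <= z < N)
      if z < y <= b m then chains b m z * multichoose y r else 0).
    rewrite big_nat [RHS]big_nat; apply: eq_bigr => y /andP[_ ltyN] /=.
    rewrite (big_nat_widen _ _ N) ?[y <= N]ltnW //= big_mkcond big_distrr big_distrl /=.
    apply: eq_bigr => z _; case: ltnP => _; last by rewrite muln0.
    by case: leqP; rewrite ?mul1n ?mul0n.
  rewrite exchange_big_nat /=; apply: eq_bigr => z _.
  rewrite [in RHS](big_nat_widenl _ 0) // [in RHS](big_nat_widen _ _ N) //= big_distrr /= [RHS]big_mkcond.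
  by apply: eq_bigr => y _; rewrite ltnS.
rewrite big_distrr /= big_nat [RHS]big_nat.
apply: eq_bigr => z _.
(* The hockey-stick identity needs [z <= b m]. A nonzero count forces [z <= b m.-1], or [z = 0] when
   [m = 0]. *)
have [->|nz] := eqVneq (chains b m z) 0; first by rewrite !mul0n muln0.
rewrite sum_multichoose; first by rewrite multichoose0 muln1 mulnC.
case: m nz {ltbN} => [|m] nz; last first.
  by apply: leq_trans (chains_gt nz) _; apply: b_mono.
by move: nz => /=; case: z.
Qed.

Local Open Scope ring_scope.

(** In the last row only the last two entries survive. The entry 1 below the diagonal has cofactor
    sign -1, and deleting its column moves the column [c] next to the first [m] columns. *)
Lemma det_hessenberg_last_column (R : comPzRingType) (h : nat -> nat -> R) (c : nat -> R) m :
    (forall i j, (j.+1 < i)%N -> h i j = 0) -> (forall j, h j.+1 j = 1) ->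
  \det (\matrix_(i < m.+2, j < m.+2) if (j < m.+1)%N then h i j else c i)
  = c m.+1 * \det (\matrix_(i < m.+1, j < m.+1) h i j)
    - \det (\matrix_(i < m.+1, j < m.+1) if (j < m)%N then h i j else c i).
Proof.
move=> h0 h1.
have gt_ord (i : 'I_m.+1) : (m < i)%N = false by rewrite ltnNge -ltnS ltn_ord.
rewrite (expand_det_row _ ord_max) big_ord_recr big_ord_recr /=.
rewrite big1 => [|j _]; last first.
  by rewrite !mxE /= ltnS ltnW // h0 ?mul0r // ltnS.
rewrite add0r !mxE /= ltnSn ltnn h1 mul1r addrC /cofactor.
congr (_ * _ + _).
  rewrite addnn -signr_odd odd_double expr0 mul1r; congr (\det _).
  by apply/matrixP => i j; rewrite !mxE /= /bump !gt_ord !add0n ltn_ord.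
rewrite addSn addnn -signr_odd /= odd_double expr1 mulN1r; congr (- \det _).
apply/matrixP => i j; rewrite !mxE /= /bump gt_ord add0n.
have [ltjm|lejm] := ltnP j m; first by rewrite add0n leqW.
by rewrite add1n ltnS ltnNge lejm.
Qed.

(** Writing [D m r] for the determinant, the Hessenberg expansion reads [D m.+1 r = multichoose (b
    m.+1) r.+1 * D m 0 - D m r.+1], which is the recursion [chain_sumS]. *)
Lemma det_multichoose_column b m r N : {homo b : i j / (i <= j)%N} -> (b m < N)%N ->
  \det (\matrix_(i < m.+1, j < m.+1)
     if (j < m)%N then (if (i <= j.+1)%N then (multichoose (b i) (j.+1 - i))%:Z else 0)
     else (multichoose (b i) (m.+1 - i + r))%:Z)
  = (chain_sum b m.+1 N r)%:Z.
Proof.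
move=> b_mono; elim: m r => [|m IHm] r ltbN.
  rewrite det_mx11 !mxE /= subn0 add1n.
  have := @chain_sumS b 0 r N b_mono ltbN.
  case: N ltbN => // N _.
  rewrite {2 3}/chain_sum !big_nat_recl // !big1 ?addn0 //.
  by rewrite multichoose0S multichoose0 muln1 addn0 muln1 => ->.
have ltbN' : (b m < N)%N by apply: leq_ltn_trans ltbN; apply: b_mono.
pose h i j := if (i <= j.+1)%N then (multichoose (b i) (j.+1 - i))%:Z else 0.
rewrite (@det_hessenberg_last_column _ h
  (fun i => (multichoose (b i) (m.+2 - i + r))%:Z) m); first last.
- by move=> j; rewrite /h leqnn subnn multichoose0.
- by move=> i j; rewrite /h ltnNge => /negbTE->.
have -> : \matrix_(i < m.+1, j < m.+1) h i j =
  \matrix_(i < m.+1, j < m.+1)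
     if (j < m)%N then (if (i <= j.+1)%N then (multichoose (b i) (j.+1 - i))%:Z else 0)
     else (multichoose (b i) (m.+1 - i + 0))%:Z.
  apply/matrixP => i j; rewrite !mxE; case: ltnP => // lemj.
  have -> : val j = m by apply/eqP; rewrite eqn_leq lemj -ltnS ltn_ord.
  by rewrite /h addn0 leqW // -ltnS.
have -> : \matrix_(i < m.+1, j < m.+1)
     (if (j < m)%N then h i j else (multichoose (b i) (m.+2 - i + r))%:Z) =
  \matrix_(i < m.+1, j < m.+1)
     if (j < m)%N then (if (i <= j.+1)%N then (multichoose (b i) (j.+1 - i))%:Z else 0)
     else (multichoose (b i) (m.+1 - i + r.+1))%:Z.
  apply/matrixP => i j; rewrite !mxE; case: ltnP => // lemj.
  by rewrite (subSn (_ : i <= m.+1)%N) ?addSnnS // ltnW.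
by rewrite !IHm // subSnn add1n -PoszM -chain_sumS // PoszD addrK.
Qed.

Lemma det_multichoose b m N : {homo b : i j / (i <= j)%N} ->
    (forall i, i < m -> b i < N)%N -> (0 < N)%N ->
  \det (\matrix_(i < m, j < m)
     if (i <= j.+1)%N then (multichoose (b i) (j.+1 - i))%:Z else 0)
  = (\sum_(0 <= y < N) chains b m y)%N%:Z.
Proof.
move=> b_mono ltbN N0; case: m ltbN => [|m] ltbN.
  by rewrite det_mx00; case: N N0 {ltbN} => // N _; rewrite big_nat_recl // big1.
have := @det_multichoose_column b m 0 N b_mono (ltbN _ (ltnSn _)).
rewrite /chain_sum; under eq_bigr do rewrite multichoose0 muln1.
move=> <-; congr (\det _).
apply/matrixP => i j; rewrite !mxE; case: ltnP => // lemj.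
have -> : val j = m by apply/eqP; rewrite eqn_leq lemj -ltnS ltn_ord.
by rewrite addn0 leqW // -ltnS.
Qed.

Local Close Scope ring_scope.

(** * Contents and the label recursion *)

(* Contents are listed with the multiplicity of the largest letter first, so that
   a new maximal letter is a [cons]. *)
Fixpoint parking_content (r : seq nat) : bool :=
  if r is x :: r' then (size r <= sumn r) && parking_content r' else true.

(* The parking contents of length [s] with nonzero part [r]. *)
Fixpoint fillings (s : nat) (r : seq nat) : seq (seq nat) :=
  if s is s'.+1 then
    if s <= sumn r then
      [seq 0 :: c | c <- fillings s' r] ++
      (if r is x :: r' then [seq x :: c | c <- fillings s' r'] else [::])
    else [::]
  else if r is [::] then [:: [::]] else [::].

Lemma sumn_nonzero c : sumn [seq x <- c | x != 0] = sumn c.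
Proof. by elim: c => //= -[|x] c IH //=; rewrite IH. Qed.

(** Since [r] has no zero entry, the head of [c] tells which of the two branches produced it. *)
Lemma mem_fillings s r c : all (fun x => x != 0) r ->
  (c \in fillings s r) =
  [&& size c == s, [seq x <- c | x != 0] == r & parking_content c].
Proof.
elim: s r c => [|s IHs] r c r0.
  case: c => [|x c] /=; last by case: r r0.
  by case: r r0.
rewrite [fillings _ _]/=; case: c => [|x c] /=.
  case: ifP => // _; rewrite mem_cat; apply/negbTE; rewrite negb_or.
  apply/andP; split; first by apply/mapP => -[].
  by case: r r0 => // y r r0; apply/mapP => -[].
rewrite eqSS.
have in_cons (y : nat) (A : seq (seq nat)) :
    (x :: c \in [seq y :: c0 | c0 <- A]) = (x == y) && (c \in A).
  apply/mapP/andP => [[c' c'A [-> ->]] | [/eqP-> cA]]; [by [] | by exists c].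
(* Deleting zeros preserves the sum, so the ballot test at this length depends on the nonzero part
   alone. *)
have -> : (size c < x + sumn c) = (size c < sumn [seq x <- x :: c | x != 0]).
  by rewrite sumn_nonzero.
case: (ltnP s (sumn r)) => [ltsr | lers]; last first.
  rewrite in_nil; apply/esym/negbTE/negP => /and4P[/eqP sc].
  by move=> /eqP/= -> /[!sc] /leq_trans/(_ lers)/[!ltnn].
have -> : [&& size c == s, (if x != 0 then x :: [seq x0 <- c | x0 != 0]
      else [seq x0 <- c | x0 != 0]) == r, size c < sumn [seq x <- x :: c | x != 0]
      & parking_content c]
  = [&& size c == s, [seq x <- x :: c | x != 0] == r & parking_content c].
  rewrite /=; case: eqP => //= ->; case: eqP => //= ->.
  by rewrite ltsr.
rewrite mem_cat in_cons IHs //=.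
case: r r0 ltsr => [|y r] /= r0 ltsr; first by [].
case/andP: r0 => y0 r0; rewrite in_cons IHs //.
case: x {in_cons} => [|x] /=.
  by rewrite orbC; case: y y0 {ltsr}.
rewrite eqseq_cons; case: eqP => //= _; by rewrite ?andbF.
Qed.

Lemma uniq_fillings s r : all (fun x => x != 0) r -> uniq (fillings s r).
Proof.
have inj_cons (x : nat) : injective (cons x) by move=> a b [].
elim: s r => [|s IHs] [|y r] //= r0; case: ifP => // _.
have /andP[y0 r0'] := r0.
rewrite cat_uniq !map_inj_uniq ?IHs //= andbT.
apply/hasPn => c /mapP[d _ ->]; apply/mapP => -[e _ [y_0]].
by rewrite y_0 in y0.
Qed.

(** The term [t_j] of the chain is the letter, counted from 0, that carries the part [a j]; letter 0
    carries [a 0]. The ballot condition at that letter says that [t_j] is at most the sum of the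
    earlier parts. In the induction on [s], the new summand [y = s] counts the contents whose top
    letter carries the last part. *)
Lemma size_fillings (a : nat -> nat) s i :
  size (fillings s (rev (mkseq a i.+1))) =
  (s <= \sum_(l < i.+1) a l) *
    \sum_(0 <= y < s) chains (fun j => \sum_(l < j.+1) a l) i y.
Proof.
have sum_rev k : sumn (rev (mkseq a k)) = \sum_(l < k) a l.
  by rewrite sumn_rev sumnE big_map -(big_mkord xpredT) /index_iota subn0.
have revS k : rev (mkseq a k.+1) = a k :: rev (mkseq a k).
  by rewrite mkseqS rev_rcons.
elim: s i => [|s IHs] i; first by rewrite revS big_geq ?muln0.
rewrite [fillings _ _]/= sum_rev; case: ltnP => lts; last by rewrite mul0n.
rewrite mul1n revS -revS size_cat size_map IHs ltnW // mul1n.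
rewrite big_nat_recr //=; congr (_ + _); rewrite size_map.
case: i {lts} => [|i]; last by rewrite IHs /=.
by rewrite /mkseq /=; case: s {IHs} => //= s; rewrite big_ord0.
Qed.

(* [label_sum r phi] is the sum of [phi L] over the words of content [r] in the
   generating tree, [L] being the number of children of the word. *)
Fixpoint label_sum (r : seq nat) (phi : nat -> nat) : nat :=
  if r is x :: r' then
    if x == 0 then label_sum r' phi
    else label_sum r' (fun L => \sum_(0 <= i < L) phi (x.+1 + i))
  else phi 1.

Lemma label_sum_nonzero r phi :
  label_sum [seq x <- r | x != 0] phi = label_sum r phi.
Proof.
by elim: r phi => //= x r IH phi; case: eqP => [_|/eqP/negbTE x0] /=; rewrite ?x0 IH.
Qed.

(** Replace a label [L] by [y], the difference between the sum of the parts so far plus [k + 1] and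
    [L]. The children of a node with value [y] then have all values above [y] up to the next bound,
    so a path in the tree becomes a bounded increasing sequence. *)
Lemma label_sum_chains (a : nat -> nat) k phi : (forall i, i <= k -> a i != 0) ->
  label_sum (rev (mkseq a k.+1)) phi =
  \sum_(0 <= y < (\sum_(l < k) a l + k).+1)
     chains (fun j => \sum_(l < j.+1) a l + j.+1) k y
     * phi ((\sum_(l < k.+1) a l + k).+1 - y).
Proof.
have revS n : rev (mkseq a n.+1) = a n :: rev (mkseq a n).
  by rewrite mkseqS rev_rcons.
elim: k phi => [|k IHk] phi a0.
  rewrite revS /= (negbTE (a0 0 _)) // big_ord0 !big_nat1.
  by rewrite mul1n subn0 !addn0 big_ord1 -addn1.
rewrite revS [label_sum _ _]/= (negbTE (a0 _ _)) //.
rewrite IHk => [|i /leqW]; last exact: a0.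
set b := (fun j => \sum_(l < j.+1) a l + j.+1); set S := \sum_(l < k) a l.
rewrite [\sum_(l < k.+2) a l]big_ord_recr /=; set T := \sum_(l < k.+1) a l.
set N := (T + k.+1).+1.
have leSN : (S + k).+1 <= N by rewrite /N /T big_ord_recr /= -/S; lia.
(* No chain ends past its last bound [S + k], so the range of [z] can be enlarged to [N]. *)
have chains0 z : S + k < z -> chains b k z = 0.
  move=> ltz; apply/eqP; apply: contraTT ltz; rewrite -leqNgt.
  by case: (k) @S {leSN} => [|j] S; [case: z | exact: chains_gt].
transitivity (\sum_(0 <= z < N) chains b k z *
    \sum_(z.+1 <= y < N) phi ((T + a k.+1 + k.+1).+1 - y)).
  rewrite (big_nat_widen _ _ N) // big_mkcond; apply: eq_bigr => z _ /=.
  case: ltnP => [ltz | /chains0->]; last by rewrite mul0n.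
  (* The child index [i] and the new value [y] run in opposite directions: [y = T + k.+1 - i]. *)
  congr (_ * _); rewrite [RHS]big_nat_rev -[X in _ = \sum_(X <= _ < _) _]add0n big_addn /=.
  have -> : N - z.+1 = (T + k).+1 - z by lia.
  rewrite big_nat [RHS]big_nat; apply: eq_bigr => i /= lti.
  by congr phi; rewrite /N; lia.
transitivity (\sum_(0 <= z < N) \sum_(0 <= y < N)
    if z < y then chains b k z * phi ((T + a k.+1 + k.+1).+1 - y) else 0).
  apply: eq_bigr => z _.
  by rewrite (big_nat_widenl _ 0) // big_distrr [LHS]big_mkcond.
rewrite exchange_big_nat big_nat [RHS]big_nat /=; apply: eq_bigr => y ltyN.
rewrite -ltnS ltyN mul1n [in RHS](big_nat_widen _ _ N) ?[y <= N]ltnW //=.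
by rewrite big_distrl /= [RHS]big_mkcond.
Qed.

(** * Words built by inserting the maximal letter *)

Definition avoids_triples (P : nat -> nat -> nat -> bool) (w : seq nat) :=
  forall x y z, subseq [:: x; y; z] w -> ~~ P x y z.

Definition has_content (r w : seq nat) := forall v, count_mem v w = nth 0 (rev r) v.

Lemma has_content_lt r w : has_content r w -> all (fun v => v < size r) w.
Proof.
move=> wr; apply/allP => v; rewrite -has_pred1 has_count wr ltnNge => v_w.
by apply: contraNltn v_w => ler; rewrite nth_default ?size_rev.
Qed.

Lemma has_content_cons x r w : all (fun v => v <= size r) w ->
  has_content (x :: r) w <->
  count_mem (size r) w = x /\ has_content r [seq v <- w | v < size r].
Proof.
move=> wr; have cnt v : count_mem v [seq v <- w | v < size r] =
    if v < size r then count_mem v w else 0.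
  rewrite count_filter; case: ltnP => [ltv | lev].
    by apply: eq_count => u /=; case: eqP => // ->.
  apply/eqP; rewrite eqn0Ngt -has_count; apply/hasPn => u _ /=.
  by case: eqP => // ->; rewrite ltnNge lev.
have nthc v : nth 0 (rev (x :: r)) v =
    if v < size r then nth 0 (rev r) v else if v == size r then x else 0.
  by rewrite rev_cons nth_rcons size_rev.
split=> [wxr | [wx wr'] v].
  split=> [|v]; first by rewrite wxr nthc ltnn eqxx.
  rewrite cnt wxr nthc; case: ltnP => // ler.
  by rewrite nth_default ?size_rev.
rewrite nthc; case: ltngtP => [ltv | gtv | ->] //.
  by rewrite -wr' cnt ltv.
apply/eqP; rewrite eqn0Ngt -has_count has_pred1; apply/negP => /(allP wr).
by rewrite leqNgt gtv.
Qed.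

Section InsertMaximum.

(* [insert m x p w] inserts [x] copies of the new maximal letter [m] into [w],
   the first of them at position [p]; the avoiding words arise from the active
   positions [p]. *)
Variables (P : nat -> nat -> nat -> bool) (active : nat -> seq nat -> bool).
Variable insert : nat -> nat -> nat -> seq nat -> seq nat.

Definition active_sites w := [seq p <- iota 0 (size w).+1 | active p w].

Hypothesis active_nil : active 0 [::].
Hypothesis perm_insert : forall m x p w, 0 < x ->
  perm_eq (insert m x p w) (nseq x m ++ w).
Hypothesis filter_insert : forall m x p w, all (fun v => v < m) w ->
  [seq v <- insert m x p w | v < m] = w.
Hypothesis index_insert : forall m x p w, 0 < x -> all (fun v => v < m) w ->
  p <= size w -> index m (insert m x p w) = p.
Hypothesis avoids_insert : forall m x p w, all (fun v => v < m) w ->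
  p <= size w -> active p w -> avoids_triples P w ->
  avoids_triples P (insert m x p w).
Hypothesis insertP : forall m w, all (fun v => v <= m) w -> m \in w ->
  avoids_triples P w ->
  exists p, let w' := [seq v <- w | v < m] in
    [/\ p <= size w', active p w' & w = insert m (count_mem m w) p w'].
Hypothesis size_active_insert : forall m x p w, 0 < x ->
  all (fun v => v < m) w -> p <= size w -> active p w ->
  size (active_sites (insert m x p w)) =
  x + count (fun p' => p' <= p) (active_sites w).

Fixpoint avoiders (r : seq nat) : seq (seq nat) :=
  if r is x :: r' then
    if x == 0 then avoiders r'
    else [seq insert (size r') x p w | w <- avoiders r', p <- active_sites w]
  else [:: [::]].

Lemma mem_active_sites p w : (p \in active_sites w) = (p <= size w) && active p w.
Proof. by rewrite mem_filter mem_iota andbC. Qed.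

Lemma avoids_filter (a : pred nat) w :
  avoids_triples P w -> avoids_triples P (filter a w).
Proof.
by move=> av x y z xyz; apply/av/(subseq_trans xyz)/filter_subseq.
Qed.

(** Every avoiding word arises from its parent, obtained by deleting the largest letter: the parent
    still avoids [P], and [insertP] supplies the site. A letter of multiplicity zero changes
    nothing. *)
Lemma avoidersP r w :
  w \in avoiders r <-> avoids_triples P w /\ has_content r w.
Proof.
elim: r w => [|x r IHr] w.
  rewrite /= inE; split=> [/eqP-> | [_ w0]]; last first.
    by case: w w0 => // y w /(_ y); rewrite nth_nil /= eqxx.
  by split=> [? ? ? | v]; rewrite ?nth_nil.
have ltle m (s : seq nat) : all (fun v => v < m) s -> all (fun v => v <= m) s.
  by apply: sub_all => v /ltnW.
have filter_all m (s : seq nat) : all (fun v => v < m) s -> [seq v <- s | v < m] = s.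
  by move=> /all_filterP.
rewrite /=; case: eqP => [-> | /eqP x0].
  rewrite IHr; split=> -[av wr]; split=> //.
    have wr' := has_content_lt wr.
    apply/has_content_cons; first exact: ltle.
    split; last by rewrite filter_all.
    by rewrite wr nth_default ?size_rev.
  have wr' := has_content_lt wr; rewrite /= in wr'.
  have [w0 wr0] := (has_content_cons 0 wr').1 wr.
  rewrite -(@filter_all (size r) w) //; apply/allP => v vw.
  have := allP wr' v vw; rewrite ltnS ltn_neqAle => ->; rewrite andbT; apply: contraTneq vw => ->.
  by rewrite -has_pred1 has_count w0.
have x_gt0 : 0 < x by rewrite lt0n.
split=> [/allpairsPdep[w' [p [/IHr[av wr]]]] | [av wr]].
  rewrite mem_active_sites => /andP[lep act] ->.
  have w'r := has_content_lt wr.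
  split; first exact: avoids_insert.
  apply/has_content_cons.
    rewrite (perm_all _ (perm_insert _ _ _ x_gt0)) all_cat all_nseq leqnn orbT.
    exact: ltle.
  rewrite filter_insert //; split=> //.
  rewrite (permP (perm_insert _ _ _ x_gt0)) count_cat count_nseq /= eqxx mul1n.
  by rewrite wr nth_default ?addn0 ?size_rev.
have wr' := has_content_lt wr; rewrite /= in wr'.
have [wx wr0] := (has_content_cons x wr').1 wr.
have mw : size r \in w by rewrite -has_pred1 has_count wx.
have [p [lep act wE]] := insertP wr' mw av.
apply/allpairsPdep; exists [seq v <- w | v < size r], p.
split; [|by rewrite mem_active_sites lep | by rewrite {1}wE wx].
by apply/IHr; split=> //; apply: avoids_filter.
Qed.

(** A child determines its parent, by deleting the maximum, and its site, as the position of the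
    first maximum. *)
Lemma uniq_avoiders r : uniq (avoiders r).
Proof.
elim: r => //= x r IHr; case: eqP => // /eqP x0.
apply: allpairs_uniq_dep => // [w _ | ].
  exact/filter_uniq/iota_uniq.
have x_gt0 : 0 < x by rewrite lt0n.
move=> _ _ /allpairsPdep[w1 [p1 [w1r p1w ->]]] /allpairsPdep[w2 [p2 [w2r p2w ->]]] /=.
have [_ /has_content_lt w1s] := (avoidersP _ _).1 w1r.
have [_ /has_content_lt w2s] := (avoidersP _ _).1 w2r.
move: p1w p2w; rewrite !mem_active_sites => /andP[lep1 _] /andP[lep2 _] eq_ins.
have := filter_insert x p1 w1s; rewrite eq_ins filter_insert // => eqw.
by rewrite -(index_insert x_gt0 w1s lep1) eq_ins -eqw index_insert.
Qed.

(* The children of a word with [L] active sites have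
   [x + 1, ..., x + L] active sites, whatever the pattern. *)
Lemma sum_avoiders r phi :
  \sum_(w <- avoiders r) phi (size (active_sites w)) = label_sum r phi.
Proof.
elim: r phi => [|x r IHr] phi.
  by rewrite big_seq1 /active_sites /= active_nil.
rewrite /=; case: eqP => [// | /eqP x0].
rewrite -IHr big_allpairs_dep big_seq [RHS]big_seq.
apply: eq_bigr => w /avoidersP[_ /has_content_lt wr].
transitivity (\sum_(p <- active_sites w)
    phi (x + count (fun p' => p' <= p) (active_sites w))).
  rewrite big_seq [RHS]big_seq; apply: eq_bigr => p.
  by rewrite mem_active_sites => /andP[lep act]; rewrite size_active_insert ?lt0n.
have: sorted ltn (active_sites w).
  exact/(sorted_filter ltn_trans)/iota_ltn_sorted.
(* Induction from the right: the largest site counts all the sites, and removing it does not affect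
   the count at any smaller site. The counts are therefore [1, ..., L]. *)
elim/last_ind: (active_sites w) => [|s p IHs] sp; first by rewrite big_nil big_geq.
rewrite size_rcons big_nat_recr //= -cats1 big_cat big_seq1 /=.
have ps : all (fun q => q < p) s.
  by move: sp; rewrite (sorted_pairwise ltn_trans) pairwise_rcons => /andP[].
rewrite count_cat /= leqnn addn0 addn1.
have -> : count (leq^~ p) s = size s.
  by apply/eqP; rewrite -all_count; apply: sub_all ps => q /ltnW.
rewrite addnS -addSn; congr (_ + _).
rewrite -IHs; last by move: sp; rewrite !(sorted_pairwise ltn_trans) pairwise_rcons => /andP[].
rewrite big_seq [RHS]big_seq; apply: eq_bigr => q /(allP ps) qp.
by rewrite count_cat /= leqNgt qp !addn0.
Qed.

Lemma size_avoiders r : size (avoiders r) = label_sum r (fun=> 1).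
Proof. by rewrite -(sum_avoiders r (fun=> 1)) sum1_size. Qed.

End InsertMaximum.

(** * Auxiliary facts on subsequences and on splitting words *)

Lemma subseq_catP (T : eqType) (s A B : seq T) : subseq s (A ++ B) ->
  exists s1 s2, [/\ s = s1 ++ s2, subseq s1 A & subseq s2 B].
Proof.
elim: A s => [|a A IHA] s; first by exists [::], s.
case: s => [|x s]; first by exists [::], [::]; rewrite !sub0seq.
rewrite /=; case: eqP => [-> | xa] /IHA[s1 [s2 [sE s1A s2B]]].
  by exists (a :: s1), s2; rewrite sE /= eqxx.
exists s1, s2; split=> //; case: s1 sE s1A => //= y s1 [<- _].
by case: eqP.
Qed.

Lemma filter_lt_id m s : all (fun v => v < m) s -> [seq v <- s | v < m] = s.
Proof. by move/all_filterP. Qed.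

Lemma filter_lt_nseq m x : [seq v <- nseq x m | v < m] = [::].
Proof. by elim: x => //= x ->; rewrite ltnn. Qed.

Lemma split_first (m : nat) w : m \in w ->
  exists s t, w = s ++ m :: t /\ m \notin s.
Proof.
elim: w => // y w IHw; rewrite inE eq_sym; case: (eqVneq y m) => [-> _ | ym /= /IHw].
  by exists [::], w.
by move=> [s [t [-> ms]]]; exists (y :: s), t; rewrite inE negb_or eq_sym ym.
Qed.

Lemma all_lt_notin m s : all (fun v => v <= m) s -> m \notin s ->
  all (fun v => v < m) s.
Proof.
move=> /allP sm ms; apply/allP => v vs; rewrite ltn_neqAle sm // andbT.
by apply: contraNneq ms => <-.
Qed.

Lemma notin_lt m s : all (fun v => v < m) s -> m \notin s.
Proof. by move=> /allP sm; apply/negP => /sm; rewrite ltnn. Qed.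

Lemma all_lt_take_drop m p s : all (fun v => v < m) s ->
  all (fun v => v < m) (take p s) /\ all (fun v => v < m) (drop p s).
Proof. by rewrite -{1}(cat_take_drop p s) all_cat => /andP. Qed.

Lemma subseq_lt m x y z w w' : all (fun v => v < m) [:: x; y; z] ->
  [seq v <- w' | v < m] = w -> subseq [:: x; y; z] w' -> subseq [:: x; y; z] w.
Proof. by move=> xyz <- sub; rewrite subseq_filter xyz. Qed.

Lemma pairwise_subseqP (r : rel nat) s :
  (forall x y, subseq [:: x; y] s -> r x y) -> pairwise r s.
Proof.
elim: s => //= a s IHs rs; apply/andP; split; last first.
  apply: IHs => x y xy; apply: rs; exact: subseq_trans xy (subseq_cons _ _).
by apply/allP => y ys; apply: rs; rewrite eqxx sub1seq.
Qed.

(** * The insertion schemes for 213 and 312 *)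

(* An index triple [a < b < c] of the word [w] carries the pattern 213 in the
   reading order by [(w_j, j)] iff [w_b < w_a <= w_c]; similarly for the others. *)
Definition triple213 x y z := (y < x) && (x <= z).
Definition triple312 x y z := (z < x) && (x <= y).

(** A new maximum can be the last letter of a forbidden triple, so no inversion may precede it. *)
Definition active213 p (w : seq nat) := pairwise leq (take p w).
(** A new maximum can be the middle letter of a forbidden triple, so no letter before it may exceed
    a letter after it. *)
Definition active312 p (w : seq nat) := allrel leq (take p w) (drop p w).

(** The copies are contiguous because [m], [y], [m] with [y < m] is a forbidden triple. *)
Definition insert213 m x p (w : seq nat) := take p w ++ nseq x m ++ drop p w.
(** All copies but the first stand at the end because [m], [m], [y] with [y < m] is a forbidden
    triple. *)
Definition insert312 m x p (w : seq nat) :=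
  take p w ++ m :: drop p w ++ nseq x.-1 m.

Lemma perm_insert213 m x p w : 0 < x -> perm_eq (insert213 m x p w) (nseq x m ++ w).
Proof. by rewrite /insert213 perm_catCA perm_cat2l cat_take_drop. Qed.

Lemma perm_insert312 m x p w : 0 < x -> perm_eq (insert312 m x p w) (nseq x m ++ w).
Proof.
case: x => // x _; rewrite /insert312 /= -cat1s perm_catCA /= perm_cons catA.
by rewrite cat_take_drop perm_catC.
Qed.

Lemma filter_insert213 m x p w : all (fun v => v < m) w ->
  [seq v <- insert213 m x p w | v < m] = w.
Proof.
move=> /(all_lt_take_drop p)[tm dm].
by rewrite !filter_cat (filter_lt_id tm) (filter_lt_id dm) filter_lt_nseq cat_take_drop.
Qed.

Lemma filter_insert312 m x p w : all (fun v => v < m) w ->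
  [seq v <- insert312 m x p w | v < m] = w.
Proof.
move=> /(all_lt_take_drop p)[tm dm]; rewrite filter_cat /= ltnn filter_cat.
by rewrite (filter_lt_id tm) (filter_lt_id dm) filter_lt_nseq cats0 cat_take_drop.
Qed.

Lemma index_insert213 m x p w : 0 < x -> all (fun v => v < m) w ->
  p <= size w -> index m (insert213 m x p w) = p.
Proof.
case: x => // x _ /(all_lt_take_drop p)[/notin_lt tm _] lep.
by rewrite index_cat (negbTE tm) /= eqxx addn0 size_takel.
Qed.

Lemma index_insert312 m x p w : 0 < x -> all (fun v => v < m) w ->
  p <= size w -> index m (insert312 m x p w) = p.
Proof.
move=> _ /(all_lt_take_drop p)[/notin_lt tm _] lep.
by rewrite index_cat (negbTE tm) /= eqxx addn0 size_takel.
Qed.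

Lemma avoids_insert213 m x p w : all (fun v => v < m) w ->
  p <= size w -> active213 p w -> avoids_triples triple213 w ->
  avoids_triples triple213 (insert213 m x p w).
Proof.
move=> wm lep act av a b c abc; apply/negP => /andP[ltba leac].
have [lecm le_m] : c <= m /\ a <= m.
  have: all (fun v => v <= m) (insert213 m x p w).
    have [tm dm] := all_lt_take_drop p wm.
    rewrite /insert213 !all_cat all_nseq leqnn orbT /=.
    by rewrite !(sub_all _ tm, sub_all _ dm) // => v /ltnW.
  by move/allP=> H; split; apply: H; apply: (mem_subseq abc); rewrite !inE eqxx ?orbT.
have [ltcm | gecm] := ltnP c m.
  have abcm : all (fun v => v < m) [:: a; b; c] by rewrite /= ltcm andbT; lia.
  by have := av _ _ _ (subseq_lt abcm (filter_insert213 x p wm) abc); rewrite /triple213 ltba leac.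
have cm : c = m by apply/eqP; rewrite eqn_leq lecm.
have [/notin_lt tm /notin_lt dm] := all_lt_take_drop p wm.
have bm : b == m = false by apply/negbTE; rewrite neq_ltn (leq_trans ltba).
suff ab : subseq [:: a; b] (take p w).
  have := subseq_pairwise ab act; rewrite /= !andbT; lia.
(* From position [p] on, the copies of [m] come first, so a smaller letter followed by [m] lies in
   the prefix; so does everything before it. *)
have nbm : ~~ subseq [:: b; m] (nseq x m ++ drop p w).
  elim: (x) => [|x' IHx] /=; last by rewrite bm.
  by apply/negP => /mem_subseq/(_ m); rewrite !inE eqxx orbT => /(_ isT); apply/negP.
move: abc; rewrite cm => /subseq_catP[[|u1 [|u2 [|u3 u]]] [v [/= uvE uw vw]]].
- by case/negP: nbm; apply: subseq_trans vw; rewrite -uvE; apply: subseq_cons.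
- by case: uvE vw => _ <- vw; rewrite vw in nbm.
- by case: uvE uw => <- <-.
- case: uvE uw => _ _ <- _ /mem_subseq/(_ m); rewrite !inE eqxx !orbT => /(_ isT).
  by rewrite (negbTE tm).
Qed.

Lemma avoids_insert312 m x p w : all (fun v => v < m) w ->
  p <= size w -> active312 p w -> avoids_triples triple312 w ->
  avoids_triples triple312 (insert312 m x p w).
Proof.
move=> wm lep act av a b c abc; apply/negP => /andP[ltca leab].
have lebm : b <= m.
  have: all (fun v => v <= m) (insert312 m x p w).
    have [tm dm] := all_lt_take_drop p wm.
    rewrite /insert312 all_cat /= all_cat all_nseq leqnn orbT andbT /=.
    by rewrite !(sub_all _ tm, sub_all _ dm) // => v /ltnW.
  by move/allP; apply; apply: (mem_subseq abc); rewrite !inE eqxx orbT.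
have [ltbm | gebm] := ltnP b m.
  have abcm : all (fun v => v < m) [:: a; b; c] by rewrite /= ltbm andbT; lia.
  by have := av _ _ _ (subseq_lt abcm (filter_insert312 x p wm) abc); rewrite /triple312 ltca leab.
have bm : b = m by apply/eqP; rewrite eqn_leq lebm.
have [/notin_lt tm /notin_lt dm] := all_lt_take_drop p wm.
have cm : c == m = false by apply/negbTE; rewrite neq_ltn; lia.
(* No smaller letter follows a later copy of [m], so the middle letter is the first copy: [a] lies
   in the prefix and [c] in the suffix. *)
have nmc : ~~ subseq [:: m; c] (drop p w ++ nseq x.-1 m).
  apply/negP => /subseq_catP[[|u1 u] [v [/= uvE uw vw]]].
    have : c \in nseq x.-1 m by apply: (mem_subseq vw); rewrite -uvE !inE eqxx orbT.
    by rewrite mem_nseq cm andbF.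
  have : u1 \in drop p w by apply: (mem_subseq uw); rewrite mem_head.
  by case: uvE => <-; rewrite (negbTE dm).
move: abc; rewrite bm => /subseq_catP[[|u1 [|u2 u]] [v [/= uvE uw vw]]].
- case/negP: nmc; move: vw; rewrite -uvE; case: eqP => // _.
  by apply: subseq_trans; apply: subseq_cons.
- case: uvE uw vw => <- <- /= /[!sub1seq] aw /[!eqxx] /[!sub1seq].
  rewrite mem_cat mem_nseq cm andbF orbF => cw.
  by have := allrelP act _ _ aw cw; rewrite leqNgt ltca.
- have : u2 \in take p w by apply: (mem_subseq uw); rewrite !inE eqxx orbT.
  by case: uvE => _ <-; rewrite (negbTE tm).
Qed.

Lemma insert213P m w : all (fun v => v <= m) w -> m \in w ->
  avoids_triples triple213 w ->
  exists p, let w' := [seq v <- w | v < m] in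
    [/\ p <= size w', active213 p w' & w = insert213 m (count_mem m w) p w'].
Proof.
move=> wm mw av; have [s [t [wE ms]]] := split_first mw.
move: wm; rewrite wE all_cat /= leqnn => /andP[sm tm].
have {}sm := all_lt_notin sm ms.
(* After the first [m], a smaller letter [y] followed by another [m] would give the forbidden triple
   [m], [y], [m]. *)
have tE : t = nseq (count_mem m t) m ++ [seq v <- t | v < m].
  have: forall y, y < m -> ~~ subseq [:: y; m] t.
    move=> y ltym; apply: contraTN isT => yt.
    have: subseq [:: m; y; m] w.
      by rewrite wE -[_ :: _]cat0s cat_subseq ?sub0seq //= eqxx.
    by move/av; rewrite /triple213 ltym leqnn.
  elim: t tm {wE} => //= y t IHt /andP[leym tm] nsub.
  have {}IHt : t = nseq (count_mem m t) m ++ [seq v <- t | v < m].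
    apply: IHt => // z /nsub; apply: contra => zt.
    exact: subseq_trans zt (subseq_cons _ _).
  case: ltngtP leym => // [ltym | ->] _ /=; last by rewrite add0n -IHt.
  have -> : count_mem m t = 0.
    apply/eqP; rewrite eqn0Ngt -has_count has_pred1; apply: contra (nsub y ltym).
    by rewrite /= eqxx sub1seq.
  rewrite /= filter_lt_id //; apply: all_lt_notin tm _.
  by apply: contra (nsub y ltym); rewrite /= eqxx sub1seq.
exists (size s); rewrite filter_cat filter_lt_id //= ltnn size_cat leq_addr.
rewrite /active213 /insert213 take_size_cat // drop_size_cat //; split=> //.
  apply: pairwise_subseqP => a b ab; rewrite leqNgt; apply/negP => ltba.
  have am : a < m by apply: (allP sm); apply: (mem_subseq ab); rewrite mem_head.
  have: subseq [:: a; b; m] w.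
    by rewrite wE -[[:: a; b; m]]/([:: a; b] ++ [:: m]) cat_subseq // sub1seq mem_head.
  by move/av; rewrite /triple213 ltba ltnW.
have -> : count_mem m (s ++ m :: t) = (count_mem m t).+1.
  by rewrite count_cat /= eqxx (count_memPn ms).
by rewrite {1}tE.
Qed.

Lemma insert312P m w : all (fun v => v <= m) w -> m \in w ->
  avoids_triples triple312 w ->
  exists p, let w' := [seq v <- w | v < m] in
    [/\ p <= size w', active312 p w' & w = insert312 m (count_mem m w) p w'].
Proof.
move=> wm mw av; have [s [t [wE ms]]] := split_first mw.
move: wm; rewrite wE all_cat /= leqnn => /andP[sm tm].
have {}sm := all_lt_notin sm ms.
(* After the first [m], another [m] followed by a smaller letter [y] would give the forbidden triple
   [m], [m], [y]. *)
have tE : t = [seq v <- t | v < m] ++ nseq (count_mem m t) m.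
  have: forall y, y < m -> ~~ subseq [:: m; y] t.
    move=> y ltym; apply: contraTN isT => yt.
    have: subseq [:: m; m; y] w.
      by rewrite wE -[_ :: _]cat0s cat_subseq ?sub0seq //= eqxx.
    by move/av; rewrite /triple312 ltym leqnn.
  elim: t tm {wE} => //= y t IHt /andP[leym tm] nsub.
  have {}IHt : t = [seq v <- t | v < m] ++ nseq (count_mem m t) m.
    apply: IHt => // z /nsub; apply: contra => zt.
    exact: subseq_trans zt (subseq_cons _ _).
  case: ltngtP leym nsub => // [ltym | ->] _ nsub /=; first by rewrite add0n -IHt.
  have -> : t = nseq (size t) m.
    apply/all_pred1P/allP => z zt /=; rewrite eqn_leq (allP tm) //= leqNgt.
    by apply/negP => /nsub; rewrite sub1seq zt.
  by rewrite filter_lt_nseq count_nseq /= eqxx mul1n.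
exists (size s); rewrite filter_cat filter_lt_id //= ltnn size_cat leq_addr.
rewrite /active312 /insert312 take_size_cat // drop_size_cat //; split=> //.
  apply/allrelP => a b asm; rewrite mem_filter => /andP[ltbm bt].
  rewrite leqNgt; apply/negP => ltba.
  have am : a < m by apply: (allP sm).
  have: subseq [:: a; m; b] w.
    by rewrite wE -[[:: a; m; b]]/([:: a] ++ [:: m; b]) cat_subseq ?sub1seq //= eqxx sub1seq.
  by move/av; rewrite /triple312 ltba ltnW.
have -> : count_mem m (s ++ m :: t) = (count_mem m t).+1.
  by rewrite count_cat /= eqxx (count_memPn ms).
by rewrite {1}tE.
Qed.

(** Common count for both schemes: sites up to [p] keep their status, and exactly [x] positions
    beyond [p] are active in the new word. *)
Lemma size_active_insertE (active : nat -> seq nat -> bool) (w w' : seq nat) p x :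
    size w' = x + size w -> p <= size w ->
    (forall q, q <= p -> active q w' = active q w) ->
    count (fun q => active q w') (iota p.+1 (x + size w - p)) = x ->
  size (active_sites active w') =
  x + count (fun q => q <= p) (active_sites active w).
Proof.
move=> size_w' lep act_le cnt.
rewrite size_filter size_w' /active_sites count_filter.
have -> : (x + size w).+1 = p.+1 + (x + size w - p) by lia.
have -> : (size w).+1 = p.+1 + (size w - p) by lia.
rewrite !iotaD !count_cat add0n cnt addnC; congr (_ + _).
rewrite -[LHS]addn0; congr (_ + _).
  apply: eq_in_count => q; rewrite mem_iota add0n ltnS /= => leq_p.
  by rewrite leq_p act_le.
apply/esym/eqP; rewrite eqn0Ngt -has_count; apply/hasPn => q.
by rewrite mem_iota /= => /andP[ltpq _]; rewrite leqNgt ltpq.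
Qed.

Lemma size_active_insert213 m x p w : 0 < x ->
  all (fun v => v < m) w -> p <= size w -> active213 p w ->
  size (active_sites active213 (insert213 m x p w)) =
  x + count (fun p' => p' <= p) (active_sites active213 w).
Proof.
move=> x0 wm lep act.
have [tm dm] := all_lt_take_drop p wm.
have size_t : size (take p w) = p by rewrite size_takel.
apply: size_active_insertE => // [|q leqp|].
- by rewrite !size_cat size_nseq size_drop size_t; lia.
- rewrite /active213 take_cat size_t; case: ltngtP leqp => // [ltqp | ->] _.
    by rewrite take_takel // ltnW.
  by rewrite subnn take0 cats0.
(* The [x] new sites are the positions [p + 1, ..., p + x] next to the copies of [m]. Any later
   prefix contains [m] followed by a smaller letter. *)
rewrite -addnBA // iotaD count_cat addnC -[RHS]add0n; congr (_ + _).
  apply/eqP; rewrite eqn0Ngt -has_count; apply/hasPn => q.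
  rewrite mem_iota => /andP[leq_q ltq]; rewrite /active213 /insert213 take_cat size_t.
  rewrite ltnNge (_ : p <= q); last by lia.
  rewrite /= take_cat size_nseq ltnNge (_ : x <= q - p); last by lia.
  case dE: (drop p w) => [|d0 d].
    by move: (congr1 size dE); rewrite size_drop /=; lia.
  have -> : q - p - x = (q - p - x).-1.+1 by lia.
  rewrite /= !pairwise_cat; apply/negP => /and3P[_ _ /and3P[]].
  move=> /allrelP/(_ m d0); rewrite mem_nseq x0 eqxx mem_head => /(_ isT isT).
  by move: dm; rewrite dE /= => /andP[]; lia.
transitivity (size (iota p.+1 x)); last exact: size_iota.
apply/eqP; rewrite -all_count; apply/allP => q.
rewrite mem_iota => /andP[leq_q ltq]; rewrite /active213 /insert213 take_cat size_t.
rewrite ltnNge (_ : p <= q); last by lia.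
rewrite /= takel_cat ?size_nseq; last by lia.
rewrite take_nseq; last by lia.
move: act; rewrite /active213 pairwise_cat => -> /=; apply/andP; split.
  apply/allrelP => a b /(allP tm)/ltnW lea; rewrite mem_nseq => /andP[_ /eqP->] //.
by elim: (q - p) => //= k ->; rewrite all_nseq leqnn orbT.
Qed.

Lemma size_active_insert312 m x p w : 0 < x ->
  all (fun v => v < m) w -> p <= size w -> active312 p w ->
  size (active_sites active312 (insert312 m x p w)) =
  x + count (fun p' => p' <= p) (active_sites active312 w).
Proof.
case: x => // x _ wm lep act.
have [tm dm] := all_lt_take_drop p wm.
have size_t : size (take p w) = p by rewrite size_takel.
have le_m s : all (fun v => v < m) s -> allrel leq s [:: m].
  by rewrite allrel1r; apply: sub_all => v /ltnW.
apply: size_active_insertE => // [|q leqp|].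
- by rewrite size_cat /= size_cat size_nseq size_drop size_t; lia.
- have -> : active312 q w = allrel leq (take q w) (drop q (take p w) ++ drop p w).
    rewrite /active312 -{2}(cat_take_drop p w) drop_cat size_t.
    case: ltngtP leqp => // -> _.
    by rewrite subnn drop0 [drop p (take _ _)]drop_oversize ?size_t.
  have -> : active312 q (insert312 m x.+1 p w) =
    allrel leq (take q w) (drop q (take p w) ++ m :: drop p w ++ nseq x m).
    rewrite /active312 /insert312 takel_cat ?size_t // take_takel // drop_cat size_t /=.
    case: ltngtP leqp => // -> _.
    by rewrite subnn drop0 [drop p (take _ _)]drop_oversize ?size_t.
  have [qm _] := all_lt_take_drop q wm.
  rewrite -cat1s !allrel_catr le_m // andTb.
  suff -> : allrel leq (take q w) (nseq x m) by rewrite andbT.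
  by apply/allrelP => a b /(allP qm)/ltnW ? ; rewrite mem_nseq => /andP[_ /eqP->].
(* The positions [p + 1, ..., size w] have an [m] on the left and a smaller letter on the right,
   hence are inactive. The last [x.+1] positions have only copies of [m] on the right, hence are
   active. *)
have -> : x.+1 + size w - p = size w - p + x.+1 by lia.
rewrite iotaD count_cat -[RHS]add0n; congr (_ + _).
  apply/eqP; rewrite eqn0Ngt -has_count; apply/hasPn => q.
  rewrite mem_iota => /andP[leq_q ltq]; rewrite /active312 /insert312.
  rewrite take_cat drop_cat size_t ltnNge (_ : p <= q) /=; last by lia.
  have -> : q - p = (q - p).-1.+1 by lia.
  rewrite /= takel_cat ?size_drop; last by lia.
  rewrite drop_cat size_drop (_ : (q - p).-1 < size w - p); last by lia.
  case dE: (drop (q - p).-1 (drop p w)) => [|d0 d].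
    by move: (congr1 size dE); rewrite !size_drop /=; lia.
  apply/negP => /allrelP/(_ m d0); rewrite mem_cat mem_head orbT mem_head => /(_ isT isT).
  by move: (all_lt_take_drop (q - p).-1 dm).2; rewrite dE /= => /andP[]; lia.
transitivity (size (iota (p.+1 + (size w - p)) x.+1)); last exact: size_iota.
apply/eqP.
rewrite -all_count; apply/allP => q.
rewrite mem_iota => /andP[leq_q ltq]; rewrite /active312 /insert312.
rewrite drop_cat size_t ltnNge (_ : p <= q) /=; last by lia.
have -> : q - p = (q - p).-1.+1 by lia.
rewrite /= drop_cat size_drop ltnNge (_ : size w - p <= (q - p).-1); last by lia.
rewrite /=; apply/allrelP => a b /mem_take aw /mem_drop.
rewrite mem_nseq => /andP[_ /eqP->].
move: aw; rewrite mem_cat inE mem_cat mem_nseq.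
by case/or4P => [/(allP tm)/ltnW | /eqP-> | /(allP dm)/ltnW | /andP[_ /eqP->]].
Qed.

Definition avoiders213 := avoiders active213 insert213.
Definition avoiders312 := avoiders active312 insert312.

Lemma avoiders213P r w :
  w \in avoiders213 r <-> avoids_triples triple213 w /\ has_content r w.
Proof.
exact (avoidersP perm_insert213 filter_insert213 avoids_insert213 insert213P r w).
Qed.

Lemma avoiders312P r w :
  w \in avoiders312 r <-> avoids_triples triple312 w /\ has_content r w.
Proof.
exact (avoidersP perm_insert312 filter_insert312 avoids_insert312 insert312P r w).
Qed.

Lemma uniq_avoiders213 r : uniq (avoiders213 r).
Proof.
exact (uniq_avoiders perm_insert213 filter_insert213 index_insert213
  avoids_insert213 insert213P r).
Qed.

Lemma uniq_avoiders312 r : uniq (avoiders312 r).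
Proof.
exact (uniq_avoiders perm_insert312 filter_insert312 index_insert312
  avoids_insert312 insert312P r).
Qed.

Lemma size_avoiders213 r : size (avoiders213 r) = label_sum r (fun=> 1).
Proof.
exact (size_avoiders isT perm_insert213 filter_insert213
  avoids_insert213 insert213P size_active_insert213 r).
Qed.

Lemma size_avoiders312 r : size (avoiders312 r) = label_sum r (fun=> 1).
Proof.
exact (size_avoiders isT perm_insert312 filter_insert312
  avoids_insert312 insert312P size_active_insert312 r).
Qed.

(** * Words of parking functions *)

Definition triple132 x y z := (x <= z) && (z < y).
Definition triple231 x y z := (y <= z) && (z < x).

(** * Reverse-complementation *)

Definition revcomp N (w : seq nat) := rev [seq N.-1 - v | v <- w].

Lemma revcomp_lt N w : all (fun v => v < N) w -> all (fun v => v < N) (revcomp N w).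
Proof.
rewrite all_rev all_map; apply: sub_all => v /= ltv; lia.
Qed.

Lemma revcompK N w : all (fun v => v < N) w -> revcomp N (revcomp N w) = w.
Proof.
move=> /allP wN; rewrite /revcomp map_rev revK -map_comp.
rewrite -[RHS]map_id; apply/eq_in_map => v /wN /=; lia.
Qed.

Lemma avoids_revcomp N (P Q : nat -> nat -> nat -> bool) w :
    (forall x y z, x < N -> y < N -> z < N ->
       Q x y z = P (N.-1 - z) (N.-1 - y) (N.-1 - x)) ->
    all (fun v => v < N) w -> avoids_triples P w ->
  avoids_triples Q (revcomp N w).
Proof.
move=> QP wN av x y z xyz.
have lt v : v \in [:: x; y; z] -> v < N.
  by move/(mem_subseq xyz)/(allP (revcomp_lt wN)).
rewrite QP ?lt ?inE ?eqxx ?orbT //; apply: av.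
move: xyz => /(map_subseq (fun v => N.-1 - v)); rewrite -subseq_rev.
by rewrite -[rev [seq _ | _ <- revcomp N w]]/(revcomp N (revcomp N w)) revcompK.
Qed.

Lemma has_content_revcomp r w :
  has_content r w -> has_content (rev r) (revcomp (size r) w).
Proof.
move=> wr; have wN := has_content_lt wr; move=> v.
rewrite revK /revcomp count_rev count_map.
have [ltv | lev] := ltnP v (size r); last first.
  rewrite nth_default //; apply/eqP; rewrite eqn0Ngt -has_count.
  apply/hasPn => u /(allP wN) /= ltu; apply/negP => /eqP; lia.
transitivity (count_mem ((size r).-1 - v) w).
  apply: eq_in_count => u /(allP wN) /= ltu; apply/eqP/eqP; lia.
rewrite wr nth_rev; [congr nth; lia | lia].
Qed.

Section RevcompAvoiders.

Variables (P Q : nat -> nat -> nat -> bool) (A : seq nat -> seq (seq nat)).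
Hypothesis QP : forall N x y z, x < N -> y < N -> z < N ->
  Q x y z = P (N.-1 - z) (N.-1 - y) (N.-1 - x).
Hypothesis AP : forall r w, w \in A r <-> avoids_triples P w /\ has_content r w.
Hypothesis uniqA : forall r, uniq (A r).

(** On words over [size r] letters, reverse-complementation is an involution that exchanges [P] with
    [Q] and reverses the content. *)
Lemma revcomp_avoidersP r w :
  w \in map (revcomp (size r)) (A (rev r)) <-> avoids_triples Q w /\ has_content r w.
Proof.
split=> [/mapP[u /AP[av ur] ->] | [av wr]].
  have uN := has_content_lt ur; rewrite size_rev in uN.
  split; first exact: avoids_revcomp (@QP _) uN av.
  by have := has_content_revcomp ur; rewrite revK size_rev.
have wN := has_content_lt wr.
apply/mapP; exists (revcomp (size r) w); last by rewrite revcompK.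
apply/AP; split; last exact: has_content_revcomp.
apply: avoids_revcomp wN av => x y z ltx lty ltz.
rewrite (@QP (size r)); try lia.
by rewrite !subKn //; lia.
Qed.

Lemma uniq_revcomp_avoiders r : uniq (map (revcomp (size r)) (A (rev r))).
Proof.
rewrite map_inj_in_uniq // => u v /AP[_ /has_content_lt ur] /AP[_ /has_content_lt vr].
rewrite size_rev in ur vr => /(congr1 (revcomp (size r))).
by rewrite !revcompK.
Qed.

End RevcompAvoiders.

(** * Words, contents and the parking condition *)

Definition word n (f : {ffun 'I_n -> 'I_n}) : seq nat := [seq val (f x) | x <- enum 'I_n].

Lemma size_word n (f : {ffun 'I_n -> 'I_n}) : size (word f) = n.
Proof. by rewrite size_map size_enum_ord. Qed.

Lemma word_lt n (f : {ffun 'I_n -> 'I_n}) : all (fun v => v < n) (word f).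
Proof. apply/allP => _ /mapP[x _ ->]; exact: ltn_ord. Qed.

Lemma word_inj n : injective (@word n).
Proof.
move=> f g fg; apply/ffunP => x; apply: val_inj.
by have /eq_in_map/(_ x) := fg; apply; rewrite mem_enum.
Qed.

Lemma word_surj n w : size w = n -> all (fun v => v < n) w ->
  exists f : {ffun 'I_n -> 'I_n}, word f = w.
Proof.
move=> sw wn; have lt (x : 'I_n) : nth 0 w x < n by apply: (all_nthP 0 wn); rewrite sw.
exists [ffun x => Ordinal (lt x)].
apply: (@eq_from_nth _ 0); rewrite size_word // => i lti.
by rewrite (nth_map (Ordinal lti)) ?size_enum_ord // ffunE /= nth_enum_ord.
Qed.

Lemma nth_pf_seq n (f : {ffun 'I_n -> 'I_n}) j : j < n ->
  nth 0 (pf_seq f) j = (nth 0 (word f) j).+1.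
Proof.
move=> ltj; have -> : pf_seq f = map succn (word f) by rewrite /word -map_comp.
by rewrite (nth_map 0) ?size_word.
Qed.

Definition content n (w : seq nat) := mkseq (fun v => count_mem v w) n.

Lemma sumn_content s w : sumn (content s w) = count (fun v => v < s) w.
Proof.
elim: s => [|s IHs]; first by rewrite /= (eq_count (a2 := pred0)) ?count_pred0.
rewrite /content mkseqS sumn_rcons -/(content s w) IHs.
rewrite -count_predUI [X in _ + X](eq_count (a2 := pred0)) => [|v /=].
  by rewrite count_pred0 addn0; apply: eq_count => v /=; lia.
by case: eqP => [->|]; rewrite ?ltnn ?andbF.
Qed.

Lemma parking_content_rev n w : parking_content (rev (content n w)) =
  all (fun s => s <= count (fun v => v < s) w) (iota 1 n).
Proof.
elim: n => // n IHn; rewrite -addn1 iotaD all_cat -IHn addn1 /content mkseqS rev_rcons.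
rewrite [LHS]/= size_rev size_mkseq andbC /= andbT add1n; congr (_ && (_ < _)).
by rewrite -[RHS]sumn_content /content mkseqS sumn_rcons sumn_rev addnC.
Qed.

(** The [i]-th smallest entry is at most [i] exactly when at least [i] entries are at most [i]; with
    letters counted from 0, these are the letters below [i]. *)
Lemma is_parkingE n (f : {ffun 'I_n -> 'I_n}) :
  is_parking f = parking_content (rev (content n (word f))).
Proof.
rewrite parking_content_rev /is_parking.
have pfE : pf_seq f = map succn (word f) by rewrite /word -map_comp.
have srt : sorted leq (sort leq (pf_seq f)) by apply: sort_sorted; exact: leq_total.
have cnt i : count (fun v => v <= i) (sort leq (pf_seq f)) =
    count (fun v => v < i) (word f).
  by rewrite count_sort pfE count_map.
apply/forallP/allP => [park s | park [i lti] /=].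
  rewrite mem_iota => /andP[s0 lts]; case: s s0 lts => // s _; rewrite add1n ltnS => lts.
 
  rewrite -cnt ltnNge; apply/negP => le_s.
  have := park (Ordinal (lts : s < n)); rewrite /= leqNgt => /negP; apply.
  apply: (@nth_count_gt _ nat s.+1 0 _ s srt).
  by rewrite size_sort {2}pfE size_map size_word lts andbT.
have := park i.+1; rewrite mem_iota add1n /= ltnS lti -cnt => /(_ isT) lt_i.
exact: (@nth_count_le _ nat i.+1 0 _ i srt).
Qed.

(** * Pattern containment in terms of the word *)

(** A list sorted for a strict order is determined by its elements, so [s] is a filter of [t]. *)
Lemma sorted_subset_subseq (T : eqType) (r : rel T) s t : transitive r -> irreflexive r ->
  sorted r s -> sorted r t -> {subset s <= t} -> subseq s t.
Proof.
move=> r_tr r_irr ss st sub.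
have -> : s = filter (mem s) t.
  apply: (irr_sorted_eq r_tr r_irr) => //; first exact: sorted_filter.
  by move=> x; rewrite mem_filter /= andb_idr // => /sub.
exact: filter_subseq.
Qed.

Lemma subseq3P (w : seq nat) x y z :
  reflect (exists i j k, [/\ i < j < k, k < size w & [:: x; y; z] =
             [:: nth 0 w i; nth 0 w j; nth 0 w k]])
    (subseq [:: x; y; z] w).
Proof.
apply: (iffP idP) => [xyz | [i [j [k [/andP[ij jk] kw ->]]]]].
  have [m _ mE] := subseqP xyz.
  have wE : w = [seq nth 0 w i | i <- iota 0 (size w)].
    by rewrite -/(mkseq _ _) mkseq_nth.
  have: subseq (mask m (iota 0 (size w))) (iota 0 (size w)) by apply: mask_subseq.
  move: mE; rewrite {1}wE -map_mask.
  case: (mask m _) => [|i [|j [|k [|? ?]]]] //= -[-> -> ->] sub.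
  exists i, j, k; split=> //.
    have := subseq_sorted ltn_trans sub (iota_ltn_sorted 0 (size w)).
    by rewrite /= andbT.
  have: k \in iota 0 (size w) by apply: (mem_subseq sub); rewrite !inE eqxx !orbT.
  by rewrite mem_iota.
rewrite -[_ :: _]/(map (nth 0 w) [:: i; j; k]).
rewrite -[X in subseq _ X](mkseq_nth 0) map_subseq //.
apply: (sorted_subset_subseq ltn_trans ltnn) => [| |l]; first by rewrite /= ij jk.
  exact: iota_ltn_sorted.
rewrite !inE mem_iota; lia.
Qed.

Lemma containsP (pi sigma : seq nat) : reflect
  (exists x y z, subseq [:: x; y; z] pi /\
     forall i j, i < 3 -> j < 3 -> (nth 0 [:: x; y; z] i < nth 0 [:: x; y; z] j) =
       (nth 0 sigma i < nth 0 sigma j))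
  (contains pi sigma).
Proof.
apply: (iffP existsP) => [[a /existsP[b /existsP[c /and3P[ab bc /forallP abc]]]] |].
  exists (nth 0 pi a), (nth 0 pi b), (nth 0 pi c); split.
    by apply/subseq3P; exists a, b, c; rewrite ab bc ltn_ord.
  move=> i j lti ltj.
  by have /forallP/(_ (Ordinal ltj))/eqP := abc (Ordinal lti).
move=> [x [y [z [/subseq3P[i [j [k [/andP[ij jk] kpi [-> -> ->]]]]] xyz]]]].
have jpi := ltn_trans jk kpi; have ipi := ltn_trans ij jpi.
exists (Ordinal ipi); apply/existsP; exists (Ordinal jpi).
apply/existsP; exists (Ordinal kpi); rewrite /= ij jk /=.
by apply/forallP => a; apply/forallP => b; rewrite xyz.
Qed.

(* [pf_perm] lists the positions [1, ..., n], hence the predecessors. *)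
Definition reading_order (w : seq nat) x y :=
  (nth 0 w x.-1 < nth 0 w y.-1) || (nth 0 w x.-1 == nth 0 w y.-1) && (x < y).

Lemma mem_pf_perm n (f : {ffun 'I_n -> 'I_n}) x :
  (x \in pf_perm f) = (0 < x <= n).
Proof.
apply/flatten_mapP/idP => [[s _ /mapP[j]] | ].
  by rewrite mem_filter mem_iota => /andP[_ ltj] ->.
case: x => // x ltx; exists (nth 0 (word f) x).+1.
  rewrite mem_iota add1n ltnS /=.
  by apply: (all_nthP 0 (word_lt f)); rewrite size_word.
by apply: map_f; rewrite mem_filter mem_iota nth_pf_seq ?eqxx.
Qed.

Lemma pf_perm_sorted n (f : {ffun 'I_n -> 'I_n}) :
  pairwise (reading_order (word f)) (pf_perm f).
Proof.
rewrite /pf_perm; set F := fun s => _.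
have memF s x : x \in F s -> (nth 0 (word f) x.-1).+1 = s.
  case/mapP=> j; rewrite mem_filter mem_iota add0n => /andP[/eqP <- ltj] ->.
  by rewrite nth_pf_seq.
have: sorted ltn (iota 1 n) by apply: iota_ltn_sorted.
rewrite (sorted_pairwise ltn_trans).
elim: (iota 1 n) => //= s t IHt /andP[/allP st /IHt{}IHt].
rewrite pairwise_cat IHt andbT; apply/andP; split.
  apply/allrelP => x y /memF xs /flatten_mapP[s' /st lts /memF ys].
  by rewrite /reading_order -ltnS xs ys lts.
apply: (@sub_in_pairwise _ (mem (F s)) ltn) => [x y xs ys ltxy||].
- rewrite /reading_order -eqSS (memF _ _ xs) (memF _ _ ys) eqxx; apply/orP; right; exact: ltxy.
- by apply/allP.
rewrite -(sorted_pairwise ltn_trans) /F (@homo_sorted _ _ _ ltn) //.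
exact/(sorted_filter ltn_trans)/iota_ltn_sorted.
Qed.

(** The permutation lists [1, ..., n] increasingly for the strict order [reading_order], so its
    subsequences are the increasing lists of positions. *)
Lemma subseq_pf_perm n (f : {ffun 'I_n -> 'I_n}) x y z :
  subseq [:: x; y; z] (pf_perm f) =
  [&& all (fun v => 0 < v <= n) [:: x; y; z],
      reading_order (word f) x y & reading_order (word f) y z].
Proof.
have r_tr : transitive (reading_order (word f)).
  by move=> b a c; rewrite /reading_order; lia.
have r_irr : irreflexive (reading_order (word f)).
  by move=> a; rewrite /reading_order; lia.
have srt := pf_perm_sorted f; rewrite -(sorted_pairwise r_tr) in srt.
apply/idP/and3P => [xyz | [xyz xy yz]].
  have /and3P[xy yz _] := subseq_sorted r_tr xyz srt.
  by split=> //; apply/allP => v /(mem_subseq xyz); rewrite mem_pf_perm.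
apply: (sorted_subset_subseq r_tr r_irr) => //; first by rewrite /= xy yz.
by move=> v /(allP xyz); rewrite mem_pf_perm.
Qed.

Lemma avoids_triplesP P w : avoids_triples P w <->
  forall i j k, i < j -> j < k -> k < size w ->
    ~~ P (nth 0 w i) (nth 0 w j) (nth 0 w k).
Proof.
split=> [av i j k ij jk kw | av x y z /subseq3P[i [j [k [/andP[ij jk] kw]]]]].
  by apply: av; apply/subseq3P; exists i, j, k; rewrite ij jk kw.
by case=> -> -> ->; apply: av.
Qed.

Lemma avoids_pf_permP n (f : {ffun 'I_n -> 'I_n}) sigma :
  avoids (pf_perm f) sigma <->
  forall x y z, x < n -> y < n -> z < n ->
    (forall i j, i < 3 -> j < 3 ->
       (nth 0 [:: x; y; z] i < nth 0 [:: x; y; z] j) = (nth 0 sigma i < nth 0 sigma j)) ->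
    ~~ (reading_order (word f) x.+1 y.+1 && reading_order (word f) y.+1 z.+1).
Proof.
have shift x y z i j : i < 3 -> j < 3 ->
    (nth 0 [:: x.+1; y.+1; z.+1] i < nth 0 [:: x.+1; y.+1; z.+1] j) =
    (nth 0 [:: x; y; z] i < nth 0 [:: x; y; z] j).
  by case: i j => [|[|[|?]]] [|[|[|?]]].
split=> [av x y z ltx lty ltz xyz | av].
  apply: contra av => /andP[xy yz]; apply/containsP; exists x.+1, y.+1, z.+1.
  split=> [|i j lti ltj]; last by rewrite shift ?xyz.
  by rewrite subseq_pf_perm xy yz /= ltx lty ltz.
apply/containsP => -[x [y [z []]]]; rewrite subseq_pf_perm => /and3P[/and4P[]].
case: x => // x ltx; case: y => // y lty; case: z => // z ltz _ xy yz xyz.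
have: ~~ (reading_order (word f) x.+1 y.+1 && reading_order (word f) y.+1 z.+1).
  by apply: av => // i j lti ltj; rewrite -shift ?xyz.
by rewrite xy yz.
Qed.

Section PatternTriples.

Variables (n : nat) (f : {ffun 'I_n -> 'I_n}).

(** Pattern values are positions of the word, so the word is read at the inverse of the pattern.
    Equal letters are listed by increasing position, hence a comparison of letters is weak where the
    pattern ascends and strict where it descends. The three sibling lemmas follow the same
    scheme. *)
Lemma avoids213E : avoids (pf_perm f) p213 <-> avoids_triples triple213 (word f).
Proof.
rewrite avoids_pf_permP avoids_triplesP size_word /triple213 /reading_order /=.
split=> [av i j k ij jk kn | av x y z ltx lty ltz xyz].
  have := av j i k; have E : forall a b, a < 3 -> b < 3 ->
    (nth 0 [:: j; i; k] a < nth 0 [:: j; i; k] b) = (nth 0 p213 a < nth 0 p213 b).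
    by move=> [|[|[|?]]] [|[|[|?]]] //= _ _; lia.
  by move=> /(_ _ _ _ E); lia.
have := xyz 1 0 isT isT; have := xyz 1 2 isT isT; have := xyz 0 2 isT isT; rewrite /= => h02 h12 h01.
have lt1 : y < x by lia.
have lt2 : x < z by lia.
have := av y x z lt1 lt2 ltz; lia.
Qed.

Lemma avoids312E : avoids (pf_perm f) p312 <-> avoids_triples triple312 (word f).
Proof.
rewrite avoids_pf_permP avoids_triplesP size_word /triple312 /reading_order /=.
split=> [av i j k ij jk kn | av x y z ltx lty ltz xyz].
  have := av k i j; have E : forall a b, a < 3 -> b < 3 ->
    (nth 0 [:: k; i; j] a < nth 0 [:: k; i; j] b) = (nth 0 p312 a < nth 0 p312 b).
    by move=> [|[|[|?]]] [|[|[|?]]] //= _ _; lia.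
  by move=> /(_ _ _ _ E); lia.
have := xyz 0 1 isT isT; have := xyz 1 2 isT isT; have := xyz 2 0 isT isT; rewrite /= => h02 h12 h01.
have lt1 : y < z by lia.
have lt2 : z < x by lia.
have := av y z x lt1 lt2 ltx; lia.
Qed.

Lemma avoids132E : avoids (pf_perm f) p132 <-> avoids_triples triple132 (word f).
Proof.
rewrite avoids_pf_permP avoids_triplesP size_word /triple132 /reading_order /=.
split=> [av i j k ij jk kn | av x y z ltx lty ltz xyz].
  have := av i k j; have E : forall a b, a < 3 -> b < 3 ->
    (nth 0 [:: i; k; j] a < nth 0 [:: i; k; j] b) = (nth 0 p132 a < nth 0 p132 b).
    by move=> [|[|[|?]]] [|[|[|?]]] //= _ _; lia.
  by move=> /(_ _ _ _ E); lia.
have := xyz 0 2 isT isT; have := xyz 2 1 isT isT; have := xyz 0 1 isT isT; rewrite /= => h02 h12 h01.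
have lt1 : x < z by lia.
have lt2 : z < y by lia.
have := av x z y lt1 lt2 lty; lia.
Qed.

Lemma avoids231E : avoids (pf_perm f) p231 <-> avoids_triples triple231 (word f).
Proof.
rewrite avoids_pf_permP avoids_triplesP size_word /triple231 /reading_order /=.
split=> [av i j k ij jk kn | av x y z ltx lty ltz xyz].
  have := av j k i; have E : forall a b, a < 3 -> b < 3 ->
    (nth 0 [:: j; k; i] a < nth 0 [:: j; k; i] b) = (nth 0 p231 a < nth 0 p231 b).
    by move=> [|[|[|?]]] [|[|[|?]]] //= _ _; lia.
  by move=> /(_ _ _ _ E); lia.
have := xyz 0 1 isT isT; have := xyz 2 0 isT isT; have := xyz 2 1 isT isT; rewrite /= => h02 h12 h01.
have lt1 : z < x by lia.
have lt2 : x < y by lia.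
have := av z x y lt1 lt2 lty; lia.
Qed.

End PatternTriples.

(** * Summation over compositions *)

Definition parts n k (a : {ffun 'I_k -> 'I_n.+1}) : seq nat :=
  [seq val (a l) | l <- enum 'I_k].

Lemma size_parts n k (a : {ffun 'I_k -> 'I_n.+1}) : size (parts a) = k.
Proof. by rewrite size_map size_enum_ord. Qed.

Lemma nth_parts n k (a : {ffun 'I_k -> 'I_n.+1}) (l : 'I_k) :
  nth 0 (parts a) l = a l.
Proof. by rewrite (nth_map l) ?size_enum_ord // nth_ord_enum. Qed.

Lemma parts_inj n k : injective (@parts n k).
Proof. by move=> a b ab; apply/ffunP => l; apply: val_inj; rewrite /= -!nth_parts ab. Qed.

Lemma is_compE n k (a : {ffun 'I_k -> 'I_n.+1}) :
  is_comp a = all (fun x => x != 0) (parts a) && (sumn (parts a) == n).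
Proof.
rewrite /is_comp sumnE big_map big_enum /=; congr (_ && _).
apply/forallP/allP => [pos _ /mapP[l _ ->] | pos l]; first by rewrite -lt0n pos.
by rewrite lt0n; apply: pos; apply: map_f; rewrite mem_enum.
Qed.

Lemma parts_surj n c : all (fun x => x != 0) c -> sumn c = n ->
  size c <= n /\ exists a : {ffun 'I_(size c) -> 'I_n.+1}, parts a = c.
Proof.
move=> c0 cn; split.
  rewrite -cn; elim: c c0 {cn} => //= x c IHc /andP[x0 /IHc]; lia.
have lt (l : 'I_(size c)) : nth 0 c l < n.+1.
  rewrite ltnS -cn sumnE (big_nth 0) big_mkord (bigD1 l) //= leq_addr //.
exists [ffun l => Ordinal (lt l)]; apply: (@eq_from_nth _ 0); rewrite size_parts // => i lti.
by rewrite -[i]/(val (Ordinal lti)) nth_parts ffunE.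
Qed.

(** Writes 1 as a sum over compositions, so that parking functions can be sorted by the nonzero part
    of their content. *)
Lemma sum_comp_parts n c : all (fun x => x != 0) c -> sumn c = n ->
  \sum_(k < n.+1) \sum_(a : {ffun 'I_k -> 'I_n.+1} | is_comp a) (parts a == c) = 1.
Proof.
move=> c0 cn; have [le_c [a aE]] := parts_surj c0 cn.
rewrite (bigD1 (Ordinal (le_c : size c < n.+1))) //= [X in _ + X]big1 => [|k].
  rewrite addn0 (bigD1 a) /= ?is_compE ?aE ?c0 ?cn ?eqxx // big1 ?addn0 // => b.
  case/andP=> _; case: (parts b =P c) => // bc /eqP[].
  by apply: parts_inj; rewrite bc aE.
rewrite -val_eqE /= => ksz; apply: big1 => b _; case: eqP => // bc.
by rewrite -bc size_parts eqxx in ksz.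
Qed.

Lemma sumn_word_content n (f : {ffun 'I_n -> 'I_n}) : sumn (content n (word f)) = n.
Proof.
rewrite sumn_content -[RHS](size_word f); apply/eqP; rewrite -all_count.
exact: word_lt.
Qed.

Lemma has_contentP r w n : size r = n -> all (fun v => v < n) w ->
  has_content r w <-> r = rev (content n w).
Proof.
move=> rn wn; split=> [wr | rE v].
  rewrite -[r]revK; congr rev; apply: (@eq_from_nth _ 0).
    by rewrite size_rev size_mkseq.
  by move=> i; rewrite size_rev rn => lti; rewrite nth_mkseq // wr.
have [ltv | lev] := ltnP v n; first by rewrite rE revK nth_mkseq.
rewrite nth_default ?size_rev ?rn //; apply/eqP; rewrite eqn0Ngt -has_count has_pred1.
by apply/negP => /(allP wn); rewrite ltnNge lev.
Qed.

Section CountAvoiders.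

Variables (n : nat) (sigma : seq nat) (P : nat -> nat -> nat -> bool).
Variables (A : seq nat -> seq (seq nat)).
Hypothesis avoidsE : forall f : {ffun 'I_n -> 'I_n},
  avoids (pf_perm f) sigma <-> avoids_triples P (word f).
Hypothesis AP : forall r w, w \in A r <-> avoids_triples P w /\ has_content r w.
Hypothesis uniqA : forall r, uniq (A r).

(** The words counted are the disjoint union of the [A r] over parking contents [r] with nonzero
    part [c]; disjointness holds because a word determines its content. *)
Lemma card_parking_avoiders c : all (fun x => x != 0) c -> sumn c = n ->
  #|[set f : {ffun 'I_n -> 'I_n} | is_parking f && avoids (pf_perm f) sigma
      & [seq x <- content n (word f) | x != 0] == c]|
  = \sum_(r <- fillings n (rev c)) size (A r).
Proof.
move=> c0 cn; have rc0 : all (fun x => x != 0) (rev c) by rewrite all_rev.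
transitivity (size [seq w | r <- fillings n (rev c), w <- A r]); last first.
  by rewrite size_allpairs_dep sumnE big_map.
rewrite cardE -(size_map (@word n)); apply: perm_size; apply: uniq_perm.
- by rewrite (map_inj_uniq (@word_inj n)) enum_uniq.
- apply: allpairs_uniq_dep => [|r _|]; [exact: uniq_fillings | exact: uniqA |].
  move=> _ _ /allpairsPdep[r1 [w1 [r1n w1r ->]]] /allpairsPdep[r2 [w2 [r2n w2r ->]]] /= w12.
  have [_ c1] := (AP _ _).1 w1r; have [_ c2] := (AP _ _).1 w2r.
  move: r1n r2n; rewrite !mem_fillings // => /and3P[/eqP s1 _ _] /and3P[/eqP s2 _ _].
  have := has_content_lt c1; rewrite s1 => lt1.
  have := has_content_lt c2; rewrite s2 => lt2.
  have r1E := (has_contentP s1 lt1).1 c1; have r2E := (has_contentP s2 lt2).1 c2.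
  by rewrite -w12 -r1E in r2E; rewrite r2E w12.
move=> w; apply/mapP/allpairsPdep => [[f] | [r [u [rn /AP[av ur] ->]]]].
  rewrite mem_enum inE => /andP[/andP[pk /avoidsE av] /eqP cf] ->.
  exists (rev (content n (word f))), (word f); split=> //.
    rewrite mem_fillings // size_rev size_mkseq eqxx filter_rev cf eqxx.
    by rewrite -is_parkingE.
  by apply/AP; split=> //; apply/(@has_contentP _ _ n); rewrite ?size_rev ?size_mkseq ?word_lt.
move: rn; rewrite mem_fillings // => /and3P[/eqP rn /eqP rc rp].
have := has_content_lt ur; rewrite rn => un.
have rE := (has_contentP rn un).1 ur.
(* The length of the word is the sum of its content, that is, the sum of [c]. *)
have su : size u = n.
  rewrite -cn -(sumn_rev c) -rc sumn_nonzero rE sumn_rev sumn_content.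
  by apply/esym/eqP; rewrite -all_count.
have [f fE] := word_surj su un.
exists f => //; rewrite mem_enum inE is_parkingE fE -rE rp /=.
have -> : avoids (pf_perm f) sigma by apply/avoidsE; rewrite fE.
by rewrite -[content _ _]revK -rE filter_rev rc revK eqxx.
Qed.

Lemma pfnE : pfn n sigma =
  \sum_(k < n.+1) \sum_(a : {ffun 'I_k -> 'I_n.+1} | is_comp a)
    \sum_(r <- fillings n (rev (parts a))) size (A r).
Proof.
pose nz (f : {ffun 'I_n -> 'I_n}) := [seq x <- content n (word f) | x != 0].
rewrite /pfn -sum1_card.
transitivity (\sum_(f in [set f : {ffun 'I_n -> 'I_n} | is_parking f && avoids (pf_perm f) sigma])
  \sum_(k < n.+1) \sum_(a : {ffun 'I_k -> 'I_n.+1} | is_comp a) (parts a == nz f)).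
  apply: eq_bigr => f _; rewrite sum_comp_parts ?filter_all //.
  by rewrite sumn_nonzero sumn_word_content.
rewrite exchange_big /=; apply: eq_bigr => k _.
rewrite exchange_big /=; apply: eq_bigr => a.
rewrite is_compE => /andP[a0 /eqP an]; rewrite -card_parking_avoiders // -sum1_card.
rewrite -big_mkcondr /=; apply: eq_bigl => f; rewrite !inE eq_sym.
by [].
Qed.

End CountAvoiders.

(** * The determinants as counts *)

Lemma partial_sum_mono (g : nat -> nat) i j :
  i <= j -> \sum_(l < i) g l <= \sum_(l < j) g l.
Proof.
by move=> leij; rewrite (big_ord_widen _ _ leij) [leqRHS](bigID (fun l : 'I_j => l < i)) leq_addr.
Qed.

Lemma mkseq_nth_size (s : seq nat) k : size s = k -> s = mkseq (nth 0 s) k.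
Proof. by move=> <-; rewrite mkseq_nth. Qed.

Lemma psum_firstE n k (a : {ffun 'I_k -> 'I_n.+1}) i : i <= k ->
  psum_first a i = \sum_(l < i) nth 0 (parts a) l.
Proof.
move=> leik; rewrite /psum_first (big_ord_widen _ _ leik).
by apply: eq_bigr => l _; rewrite nth_parts.
Qed.

Lemma psum_lastE n k (a : {ffun 'I_k -> 'I_n.+1}) i : i <= k ->
  psum_last a i = \sum_(l < i) nth 0 (rev (parts a)) l.
Proof.
move=> leik; rewrite /psum_last (big_ord_widen _ _ leik) (reindex_inj rev_ord_inj) /=.
apply: eq_big => [l | l _]; first by have := ltn_ord l; lia.
by rewrite nth_rev size_parts // (nth_parts a (rev_ord l)).
Qed.

Local Open Scope ring_scope.

(** Positivity of [b] keeps the top nonnegative down to the subdiagonal [i = j + 1], where it equals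
    [b - 1]. *)
Lemma binz_multichoose (b i j : nat) (N r : int) : (0 < b)%N ->
  N = b%:Z + j%:Z - i%:Z -> r = j.+1%:Z - i%:Z ->
  binz N r = if (i <= j.+1)%N then (multichoose b (j.+1 - i))%:Z else 0.
Proof.
move=> b0 NE rE; rewrite /binz; case: leqP => [leij | ltji].
  have -> : (0 <= r) && (0 <= N) by lia.
  by rewrite /multichoose; congr (Posz 'C(_, _)); lia.
by have -> : (0 <= r) && (0 <= N) = false by lia.
Qed.

Lemma binz_sub_multichoose (b i j : nat) : (0 < b)%N ->
  binz (j.+1%:Z - i.+1%:Z + b%:Z) (j.+1%:Z - (i.+1%:Z - 1))
  = if (i <= j.+1)%N then (multichoose b (j.+1 - i))%:Z else 0.
Proof. by move=> b0; apply: binz_multichoose => //; lia. Qed.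

(** The top lacks the term [-i] of the first determinant; this raises the bound by the row number
    [i.+1], as the chains of labels require. *)
Lemma binz_add_multichoose (b i j : nat) :
  binz (j.+1%:Z + b%:Z) (j.+1%:Z - (i.+1%:Z - 1))
  = if (i <= j.+1)%N then (multichoose (b + i.+1) (j.+1 - i))%:Z else 0.
Proof. by apply: binz_multichoose; lia. Qed.

Lemma detA_size_fillings n k (a : {ffun 'I_k -> 'I_n.+1}) : (0 < n)%N -> is_comp a ->
  detA a = (size (fillings n (rev (parts a))))%:Z.
Proof.
rewrite is_compE => n0 /andP[/allP a0 /eqP an].
case: k a a0 an => [|k] a a0 an.
  by rewrite -an /parts [enum _]size0nil ?size_enum_ord in n0.
set g := nth 0%N (parts a).
have gE := mkseq_nth_size (size_parts a); rewrite -/g in gE.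
have g0 i : (i <= k)%N -> (0 < g i)%N.
  by move=> lei; rewrite lt0n; apply/a0/mem_nth; rewrite size_parts.
have gn : (\sum_(l < k.+1) g l)%N = n.
  by rewrite -an gE sumnE big_map -(big_mkord xpredT) /index_iota subn0.
rewrite [in RHS]gE size_fillings gn leqnn mul1n -det_multichoose //.
- congr (\det _); apply/matrixP => i j; rewrite !mxE.
  have ltik : (i < k)%N := ltn_ord i.
  rewrite psum_firstE ?ltnS ?(ltnW ltik) // binz_sub_multichoose //.
  by rewrite big_ord_recl ltn_addr // g0.
- by move=> i j leij; apply: partial_sum_mono.
(* The cutoff [n] exceeds every bound because the last part, which no bound includes, is
   positive. *)
move=> i ltik; apply: leq_ltn_trans (partial_sum_mono g ltik) _.
by rewrite -gn big_ord_recr /= -[ltnLHS]addn0 ltn_add2l g0.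
Qed.

Lemma det_label_sum k (g : nat -> nat) (p : nat -> nat) :
    (forall i, i <= k -> g i != 0)%N ->
    (forall i, i < k -> p i.+1 = \sum_(l < i.+1) g l)%N ->
  \det (\matrix_(i < k, j < k)
     binz (j.+1%:Z + (p i.+1)%:Z) (j.+1%:Z - (i.+1%:Z - 1)))
  = (label_sum (rev (mkseq g k.+1)) (fun=> 1%N))%:Z.
Proof.
move=> g0 pE; rewrite label_sum_chains //.
under eq_bigr do rewrite muln1.
rewrite -det_multichoose //.
- congr (\det _); apply/matrixP => i j; rewrite !mxE.
  by rewrite pE ?ltn_ord // binz_add_multichoose.
- by move=> i j leij; rewrite leq_add // partial_sum_mono.
by move=> i ltik; rewrite ltnS leq_add // partial_sum_mono.
Qed.

Lemma detC_label_sum n k (a : {ffun 'I_k.+1 -> 'I_n.+1}) : is_comp a ->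
  detC a = (label_sum (rev (parts a)) (fun=> 1%N))%:Z.
Proof.
rewrite is_compE => /andP[/allP a0 _].
have gE := mkseq_nth_size (size_parts a).
rewrite [in RHS]gE -(@det_label_sum _ _ (psum_first a)) // => i lei.
  by apply/a0/mem_nth; rewrite size_parts.
by rewrite psum_firstE // ltnW.
Qed.

Lemma detB_label_sum n k (a : {ffun 'I_k.+1 -> 'I_n.+1}) : is_comp a ->
  detB a = (label_sum (parts a) (fun=> 1%N))%:Z.
Proof.
rewrite is_compE => /andP[/allP a0 _].
have gE : rev (parts a) = mkseq (nth 0%N (rev (parts a))) k.+1.
  by apply: mkseq_nth_size; rewrite size_rev size_parts.
rewrite -[in RHS](revK (parts a)) [in RHS]gE -(@det_label_sum _ _ (psum_last a)) // => i lei.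
  by apply: a0; rewrite -mem_rev mem_nth // size_rev size_parts.
by rewrite psum_lastE // ltnW.
Qed.

Local Close Scope ring_scope.

(** The number of avoiding words depends only on the nonzero part of the content, so it factors out
    of the sum over fillings. The map [h] is the identity for 213 and 312, and [rev] for 132 and
    231. *)
Lemma pfn_label_sum n sigma P A (h : seq nat -> seq nat) :
    (forall f : {ffun 'I_n -> 'I_n},
       avoids (pf_perm f) sigma <-> avoids_triples P (word f)) ->
    (forall r w, w \in A r <-> avoids_triples P w /\ has_content r w) ->
    (forall r, uniq (A r)) ->
    (forall r, size (A r) = label_sum (h r) (fun=> 1)) ->
    (forall r, [seq x <- h r | x != 0] = h [seq x <- r | x != 0]) ->
  pfn n sigma =
  \sum_(k < n.+1) \sum_(a : {ffun 'I_k -> 'I_n.+1} | is_comp a)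
    size (fillings n (rev (parts a))) * label_sum (h (rev (parts a))) (fun=> 1).
Proof.
move=> avE AP uniqA sizeA hE; rewrite (pfnE avE AP uniqA).
apply: eq_bigr => k _; apply: eq_bigr => a; rewrite is_compE => /andP[a0 _].
rewrite -sum1_size big_distrl /= big_seq [RHS]big_seq; apply: eq_bigr => r.
rewrite mem_fillings ?all_rev // => /and3P[_ /eqP <- _].
by rewrite mul1n sizeA -hE label_sum_nonzero.
Qed.

Theorem theorem4p3 (n : nat) : (0 < n)%N ->
  [/\ pfn n p132 = pfn n p231,
      Posz (pfn n p231) = rhs1 n,
      pfn n p213 = pfn n p312 &
      Posz (pfn n p312) = rhs2 n].
Proof.
move=> n0.
have triple_rev132 N x y z : x < N -> y < N -> z < N ->
    triple132 x y z = triple213 (N.-1 - z) (N.-1 - y) (N.-1 - x).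
  by rewrite /triple132 /triple213; lia.
have triple_rev231 N x y z : x < N -> y < N -> z < N ->
    triple231 x y z = triple312 (N.-1 - z) (N.-1 - y) (N.-1 - x).
  by rewrite /triple231 /triple312; lia.
have nz_id (r : seq nat) : [seq x <- id r | x != 0] = id [seq x <- r | x != 0] by [].
have nz_rev (r : seq nat) : [seq x <- rev r | x != 0] = rev [seq x <- r | x != 0].
  exact: filter_rev.
have pf213 := pfn_label_sum (@avoids213E n) avoiders213P uniq_avoiders213
  size_avoiders213 nz_id.
have pf312 := pfn_label_sum (@avoids312E n) avoiders312P uniq_avoiders312
  size_avoiders312 nz_id.
have pf132 := pfn_label_sum (@avoids132E n)
  (revcomp_avoidersP triple_rev132 avoiders213P)
  (uniq_revcomp_avoiders avoiders213P uniq_avoiders213)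
  (fun r => etrans (size_map _ _) (size_avoiders213 (rev r))) nz_rev.
have pf231 := pfn_label_sum (@avoids231E n)
  (revcomp_avoidersP triple_rev231 avoiders312P)
  (uniq_revcomp_avoiders avoiders312P uniq_avoiders312)
  (fun r => etrans (size_map _ _) (size_avoiders312 (rev r))) nz_rev.
(* The determinant formulas for the label sums are stated for at least one part; [k = 0] contributes
   nothing as [n] is positive. *)
have comp_nonempty (a : {ffun 'I_0 -> 'I_n.+1}) : is_comp a = false.
  by rewrite /is_comp big_ord0 eq_sym gtn_eqF // andbF.
split; first by rewrite pf132 pf231.
- rewrite pf231 /rhs1 (big_morph Posz PoszD (erefl _)).
  apply: eq_bigr => k _; rewrite (big_morph Posz PoszD (erefl _)).
  (* The two reversals cancel, so blocks are inserted from the last part to the first; this is why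
     partial sums from the end appear. *)
  apply: eq_bigr => a ac; rewrite PoszM -detA_size_fillings // revK.
  by case: (k : nat) a ac => [a | m a ac]; [rewrite comp_nonempty | rewrite detB_label_sum].
- by rewrite pf213 pf312.
rewrite pf312 /rhs2 (big_morph Posz PoszD (erefl _)).
apply: eq_bigr => k _; rewrite (big_morph Posz PoszD (erefl _)).
apply: eq_bigr => a ac; rewrite PoszM -detA_size_fillings //.
by case: (k : nat) a ac => [a | m a ac]; [rewrite comp_nonempty | rewrite detC_label_sum].
Qed.
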